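(* Let $p\ge1$, suppose that $q=1$ and that $h$ is convex (and nonzero). Then the AR$qp$C algorithm (see context) applied to minimize $w=f+h(c(\cdot))$ with accuracy $\epsilon_1=\epsilon$ may require $$\epsilon^{-\frac{p+1}{p}}$$ iterations and evaluations of $f$ and $c$ and of their derivatives of order one up to $p$ to produce a point $x_\epsilon$ such that $\phi_{w,1}^{1}(x_\epsilon)\le\epsilon$. That is: for $\epsilon\in(0,1)$ there exist a problem with $h$ convex and nonzero satisfying AS.1–AS.4, a starting point, algorithm parameters (with $q=1$) and an admissible execution of the algorithm for which at least $\epsilon^{-(p+1)/p}$ iterations, and as many evaluations of $f$, $c$ and their derivatives of orders one to $p$, are performed before the algorithm terminates with such a point $x_\epsilon$.
   Context: Problem. $n,m,p,q\ge1$ are integers with $q\le p$ (here $q=1$); $\mathcal F\subseteq\mathbb R^n$ is a nonempty feasible set; $f:\mathbb R^n\to\mathbb R$, $c:\mathbb R^n\to\mathbb R^m$, $h:\mathbb R^m\to\mathbb R$; one minimizes $w(x)=f(x)+h(c(x))$ over $x\in\mathcal F$. $\|\cdot\|$ is the Euclidean norm, or the induced operator norm for tensors. Minima written below are implicitly assumed to be attained. Assumptions. - AS.1: $f$ is $p$ times continuously differentiable and, for every $j\in\{1,\dots,p\}$, there is $L_{f,j}\ge1$ with $\|\nabla_x^jf(x)-\nabla_x^jf(y)\|\le L_{f,j}\|x-y\|$ for all $x,y$ in a convex open neighbourhood of $\mathcal F$. - AS.2: $c$ is $p$ times continuously differentiable and, for every $j\in\{1,\dots,p\}$, there is $L_{c,j}\ge1$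 with $\|\nabla_x^jc(x)-\nabla_x^jc(y)\|\le L_{c,j}\|x-y\|$ for all $x,y$ in a convex open neighbourhood of $\mathcal F$. - AS.3: there is $L_{h,0}\ge0$ with $|h(x)-h(y)|\le L_{h,0}\|x-y\|$ for all $x,y\in\mathbb R^m$; moreover $h(x+y)\le h(x)+h(y)$ for all $x,y$, and $h(0)=0$. - AS.4: there is $w_{\rm low}$ with $w(x)\ge w_{\rm low}$ for all $x\in\mathcal F$. Taylor models and optimality measure. $T_{r,j}(x,s)=\sum_{\ell=0}^j\frac1{\ell!}\nabla_x^\ell r(x)[s]^\ell$ for $r=f$ or $r=c$; $T_{w,j}(x,s)=T_{f,j}(x,s)+h(T_{c,j}(x,s))$ (not a Taylor expansion); for $\delta>0$, $\phi_{w,j}^{\delta}(x)=w(x)-\min_{x+d\in\mathcal F,\ \|d\|\le\delta}T_{w,j}(x,d)$. Regularized model at iteration $k$: $m_k(s)=T_{w,p}(x_k,s)+\frac{\sigma_k}{(p+1)!}\|s\|^{p+1}$. Its optimality measure, for $j\le q$, is $$\phi_{m_k,j}^{\delta}(s)=m_k(s)-\min_{x_k+s+d\in\mathcal F,\ \|d\|\le\delta}\Big[\sum_{\ell=0}^j\tfrac1{\ell!}\nabla_s^\ell T_{f,p}(x_k,s)[d]^\ell+h\Big(\sum_{\ell=0}^j\tfrac1{\ell!}\nabla_s^\ell T_{c,p}(x_k,s)[d]^\ell\Big)+\tfrac{\sigma_k}{(p+1)!}\sum_{\ell=0}^j\tfrac1{\ell!}\nabla_s^\ell(\|s\|^{p+1})[d]^\ell\Big].$$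 Algorithm AR$qp$C. - Step 0: given are $x_0\in\mathcal F$, $\sigma_0>0$, accuracies $\epsilon_1,\dots,\epsilon_q\in(0,1)$, $\delta_0\in(0,1]^q$, $\theta\in(0,1)$, $\sigma_{\min}\in(0,\sigma_0]$, $0<\eta_1\le\eta_2<1$, $0<\gamma_1<1<\gamma_2<\gamma_3$. Compute $w(x_0)$; set $k=0$. - Step 1: evaluate derivatives of $f,c$ at $x_k$ of orders $1,\dots,q$. If $\phi_{w,j}^{\delta_{k,j}}(x_k)\le\epsilon_j\delta_{k,j}^j/j!$ for all $j\in\{1,\dots,q\}$, terminate with $x_\epsilon=x_k$. Otherwise evaluate the derivatives of orders $q+1,\dots,p$. - Step 2: compute a nonzero step $s_k$ with $x_k+s_k\in\mathcal F$ and radii $\delta_s\in(0,1]^q$ such that $m_k(s_k)\le m_k(0)$ and $\phi_{m_k,j}^{\delta_{s,j}}(s_k)\le\theta\epsilon_j\delta_{s,j}^j/j!$ for all $j\in\{1,\dots,q\}$. If no such pair exists, terminate with $x_\epsilon=x_k$. - Step 3: compute $w(x_k+s_k)$ and $\rho_k=\dfrac{w(x_k)-w(x_k+s_k)}{w(x_k)-T_{w,p}(x_k,s_k)}$. If $\rho_k\ge\eta_1$ set $x_{k+1}=x_k+s_k$, $\delta_{k+1}=\delta_s$ (successful iteration); otherwise $x_{k+1}=x_k$, $\delta_{k+1}=\delta_k$. - Step 4: choose $\sigma_{k+1}\in[\max(\sigma_{\min},\gamma_1\sigma_k),\sigma_k]$ if $\rho_k\ge\eta_2$; $\sigma_{k+1}\in[\sigma_k,\gamma_2\sigma_k]$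 if $\rho_k\in[\eta_1,\eta_2)$; $\sigma_{k+1}\in[\gamma_2\sigma_k,\gamma_3\sigma_k]$ if $\rho_k<\eta_1$. Increment $k$; go to Step 1 if the iteration just completed was successful, to Step 2 otherwise. *)

(* Defs.v *)
From HB Require Import structures.
From mathcomp Require Import all_boot all_order all_algebra.
From mathcomp Require Import all_classical all_reals all_analysis.

Set Implicit Arguments.
Unset Strict Implicit.
Unset Printing Implicit Defensive.

Import Order.TTheory GRing.Theory Num.Theory.
Import numFieldNormedType.Exports.

Local Open Scope classical_set_scope.
Local Open Scope ring_scope.

(* The library's norm on 'rV[R]_n is the sup norm; it is used only through the
   topology and the differential, which do not depend on the choice of norm.
   All metric statements below use the Euclidean norm. *)
Definition enorm (R : realType) (n : nat) (x : 'rV[R]_n) : R :=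
  Num.sqrt (\sum_(i < n) x 0 i ^+ 2).

Section Derivatives.
Context {R : realType} {n : nat} {W : normedModType R}.
Local Notation V := 'rV[R]_n.
Implicit Types (r : V -> W) (x s : V).

Fixpoint continuously_differentiable (k : nat) r : Prop :=
  if k is k'.+1 then
    (forall x, differentiable r x) /\
    (forall v : V, continuously_differentiable k' (fun x => 'd r x v))
  else continuous r.

(* nabla r [:: v1; ...; vl] x is the value of the l-th derivative tensor of r
   at x on the vectors v1, ..., vl. *)
Fixpoint nabla r (vs : seq V) : V -> W :=
  if vs is v :: vs' then fun x => 'd (nabla r vs') x v else r.

Definition taylor r (j : nat) x s : W :=
  \sum_(l < j.+1) (l`!%:R)^-1 *: nabla r (nseq l s) x.

(* Operator norm induced by the Euclidean norm on V and the norm nW on W; it is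
   extended-real valued so that an unbounded map has norm +oo. *)
Definition tensor_norm (nW : W -> R) (l : nat) (T : l.-tuple V -> W) : \bar R :=
  ereal_sup [set (nW (T v))%:E
            | v in [set v : l.-tuple V | forall i, enorm (tnth v i) <= 1]].

Definition lipschitz_derivatives (nW : W -> R) (p : nat) (F : set V) r : Prop :=
  continuously_differentiable p r /\
  exists U : set V, [/\ open U, convex_set U, F `<=` U &
    forall j, (1 <= j <= p)%N -> exists2 L : R, 1 <= L &
      forall x y, U x -> U y ->
        (tensor_norm nW (fun v : j.-tuple V => nabla r v x - nabla r v y)%R
           <= (L * enorm (x - y))%:E)%E].

End Derivatives.

Record problem (R : realType) (n m : nat) := Problem {
  feasible : set 'rV[R]_n;
  obj_f : 'rV[R]_n -> R^o;
  obj_c : 'rV[R]_n -> 'rV[R]_m;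
  obj_h : 'rV[R]_m -> R^o
}.

Section Models.
Context {R : realType} {n m : nat} (P : problem R n m).
Local Notation V := 'rV[R]_n.
Local Notation F := (feasible P).
Local Notation f := (obj_f P).
Local Notation c := (obj_c P).
Local Notation h := (obj_h P).
Implicit Types (x s d : V) (sigma delta : R).

Definition obj_w x : R := f x + h (c x).

Definition AS1 (p : nat) : Prop :=
  lipschitz_derivatives (fun t : R^o => `|t|) p F f.

Definition AS2 (p : nat) : Prop := lipschitz_derivatives (@enorm R m) p F c.

Definition AS3 : Prop :=
  [/\ exists2 L : R, 0 <= L & forall x y : 'rV[R]_m, `|h x - h y| <= L * enorm (x - y),
      forall x y : 'rV[R]_m, h (x + y) <= h x + h y
    & h 0 = 0].

Definition AS4 : Prop := exists wlow : R, forall x, F x -> wlow <= obj_w x.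

Definition taylor_w (j : nat) x s : R := taylor f j x s + h (taylor c j x s).

(* Minima are written as inf; minima_attained below is the standing assumption
   that every one of these infima is a minimum. *)
Definition w_values (j : nat) delta x : set R :=
  [set taylor_w j x d | d in [set d | F (x + d) /\ enorm d <= delta]].

Definition phi_w (j : nat) delta x : R := obj_w x - inf (w_values j delta x).

Definition model (p : nat) sigma x s : R :=
  taylor_w p x s + sigma / (p.+1)`!%:R * enorm s ^+ p.+1.

Definition model_taylor (p : nat) sigma x (j : nat) s d : R :=
  taylor (taylor f p x) j s d + h (taylor (taylor c p x) j s d)
  + sigma / (p.+1)`!%:R
    * taylor ((fun t => enorm t ^+ p.+1) : V -> R^o) j s d.

Definition model_values (p : nat) sigma x (j : nat) delta s : set R :=
  [set model_taylor p sigma x j s d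
  | d in [set d | F (x + s + d) /\ enorm d <= delta]].

Definition phi_model (p : nat) sigma x (j : nat) delta s : R :=
  model p sigma x s - inf (model_values p sigma x j delta s).

Definition has_min (A : set R) : Prop := exists2 a, A a & lbound A a.

Definition minima_attained (p q : nat) : Prop :=
  (forall j delta x, (1 <= j <= q)%N -> 0 < delta -> F x ->
     has_min (w_values j delta x)) /\
  (forall sigma j delta x s, 0 < sigma -> (1 <= j <= q)%N -> 0 < delta ->
     F x -> F (x + s) -> has_min (model_values p sigma x j delta s)).

End Models.

(* Vectors indexed by the orders j = 1, ..., q are row vectors of length q: the
   component of index i : 'I_q belongs to the order j = i.+1. *)
Record parameters (R : realType) (n q : nat) := AlgParams {
  par_x0 : 'rV[R]_n;
  par_sigma0 : R;
  par_eps : 'rV[R]_q;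
  par_delta0 : 'rV[R]_q;
  par_theta : R;
  par_sigma_min : R;
  par_eta1 : R;
  par_eta2 : R;
  par_gamma1 : R;
  par_gamma2 : R;
  par_gamma3 : R
}.

Record iterates (R : realType) (n q : nat) := Iterates {
  it_x : nat -> 'rV[R]_n;
  it_s : nat -> 'rV[R]_n;
  it_delta : nat -> 'rV[R]_q;
  it_delta_s : nat -> 'rV[R]_q;
  it_sigma : nat -> R
}.

Section Algorithm.
Context {R : realType} {n m q : nat}.
Variables (P : problem R n m) (p : nat) (par : parameters R n q).

Definition valid_radii (delta : 'rV[R]_q) : Prop :=
  forall i, 0 < delta 0 i <= 1.

Definition valid_parameters : Prop :=
  (1 <= q <= p)%N /\
  [/\ feasible P (par_x0 par),
      0 < par_sigma_min par <= par_sigma0 par,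
      (forall i, 0 < par_eps par 0 i < 1),
      valid_radii (par_delta0 par)
    & 0 < par_theta par < 1] /\
  [/\ 0 < par_eta1 par, par_eta1 par <= par_eta2 par, par_eta2 par < 1,
      0 < par_gamma1 par < 1
    & 1 < par_gamma2 par < par_gamma3 par].

Definition step1_stop (x : 'rV[R]_n) (delta : 'rV[R]_q) : bool :=
  [forall i : 'I_q, phi_w P i.+1 (delta 0 i) x
     <= par_eps par 0 i * delta 0 i ^+ i.+1 / (i.+1)`!%:R].

Definition step2_pair (x : 'rV[R]_n) (sigma : R) (s : 'rV[R]_n)
    (delta : 'rV[R]_q) : Prop :=
  [/\ s != 0, feasible P (x + s), valid_radii delta,
      model P p sigma x s <= model P p sigma x 0
    & forall i : 'I_q, phi_model P p sigma x i.+1 (delta 0 i) s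
        <= par_theta par * par_eps par 0 i * delta 0 i ^+ i.+1
           / (i.+1)`!%:R].

Variable it : iterates R n q.
Local Notation x := (it_x it).
Local Notation s := (it_s it).
Local Notation delta := (it_delta it).
Local Notation delta_s := (it_delta_s it).
Local Notation sigma := (it_sigma it).

Definition rho (k : nat) : R :=
  (obj_w P (x k) - obj_w P (x k + s k))
  / (obj_w P (x k) - taylor_w P p (x k) (s k)).

Definition successful (k : nat) : bool := par_eta1 par <= rho k.

(* Iteration k enters Step 1 iff it is the first one or its predecessor was
   successful; otherwise it starts directly at Step 2. *)
Definition enters_step1 (k : nat) : bool :=
  if k is k'.+1 then successful k' else true.

Definition stops_at_step1 (k : nat) : bool :=
  enters_step1 k && step1_stop (x k) (delta k).

Definition sigma_update (k : nat) : Prop :=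
  [/\ par_eta2 par <= rho k ->
        Num.max (par_sigma_min par) (par_gamma1 par * sigma k)
          <= sigma k.+1 <= sigma k,
      par_eta1 par <= rho k < par_eta2 par ->
        sigma k <= sigma k.+1 <= par_gamma2 par * sigma k
    & rho k < par_eta1 par ->
        par_gamma2 par * sigma k <= sigma k.+1 <= par_gamma3 par * sigma k].

Definition complete_iteration (k : nat) : Prop :=
  [/\ ~~ stops_at_step1 k,
      step2_pair (x k) (sigma k) (s k) (delta_s k),
      x k.+1 = if successful k then x k + s k else x k,
      delta k.+1 = if successful k then delta_s k else delta k
    & sigma_update k].

Definition terminates_at (k : nat) : Prop :=
  stops_at_step1 k \/
  ~ exists s' delta', step2_pair (x k) (sigma k) s' delta'.

(* The algorithm performs the N complete iterations 0, ..., N-1 and terminates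
   during iteration N, with x_eps = x N. *)
Definition execution (N : nat) : Prop :=
  [/\ x 0%N = par_x0 par, delta 0%N = par_delta0 par,
      sigma 0%N = par_sigma0 par,
      forall k, (k < N)%N -> complete_iteration k
    & terminates_at N].

(* f and c are evaluated at x0 and, for k < N, at x k + s k. *)
Definition function_evaluations (N : nat) : nat := N.+1.

(* The derivatives of order j are evaluated in Step 1: if j <= q, each time
   this step is entered; if q < j <= p, when moreover it does not stop. *)
Definition derivative_evaluations (N j : nat) : nat :=
  \sum_(k < N.+1 | enters_step1 k && ((j <= q)%N || ~~ stops_at_step1 k)) 1.

End Algorithm.

(* Main.v *)
From HB Require Import structures.
Require Import Defs.
From mathcomp Require Import all_boot all_order all_algebra.
From mathcomp Require Import all_classical all_reals all_analysis.
From mathcomp Require Import ring lra.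
Import Order.TTheory GRing.Theory Num.Theory.
Import numFieldNormedType.Exports.
Local Open Scope classical_set_scope.
Local Open Scope ring_scope.

(** A one-dimensional problem in which every model is exact already forces this
many iterations.  On the segment [0, B] take f = 0, c x = 2 eps (B - x) and
h y = |y|, so that w x = 2 eps (B - x) has constant slope 2 eps and
phi_w 1 x = 2 eps min(1, B - x): this measure exceeds eps until x is within 1/2
of the right end of the segment.

Since c is affine, its Taylor polynomials of positive degree are c itself
([taylor_affine]), hence rho = 1 at every iteration: every step is accepted and
the regularization parameter may be kept at its initial value 2 p!.  With this
value the model w x - 2 eps s + 2 p! / (p+1)! s^(p+1) is stationary at
s = t := eps^(1/p), so its first-order measure vanishes there
([phi_model_exact_step]) and s = t is an admissible step.  Each iteration thus
moves by only eps^(1/p) and lowers w by only 2 eps^((p+1)/p).  Taking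
B = N t + 1/2 makes the method pass through 0, t, ..., N t and stop exactly at
N t, where N is the first integer above eps^(-(p+1)/p).

The complexity is not due to a degenerating family of problems: the slope of c
is at most 2, h is 1-Lipschitz, w >= 0, and w(x0) = 2 eps (N t + 1/2) <= 5 for
all eps < 1. *)

(** * Taylor models of affine maps *)

Section Affine.
Context {R : realType} {n : nat} {W : normedModType R}.
Local Notation V := 'rV[R]_n.
Variables (b : W) (L : {linear V -> W}).
Hypothesis L_cont : continuous L.
Let r : V -> W := fun x => b + L x.

Lemma diff_affine x : differentiable r x /\ 'd r x = L :> (V -> W).
Proof.
have dL : differentiable L x by exact: linear_differentiable.
have db : differentiable (cst b : V -> W) x by exact: differentiable_cst.
have -> : r = cst b + L by [].
split; first exact: differentiableD.
rewrite diffD // diff_cst diff_lin //.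
by apply/funext => y; rewrite -[LHS]/(0 + L y) add0r.
Qed.

Lemma nabla_affine1 v : nabla r [:: v] = fun=> L v.
Proof. by apply/funext => x /=; rewrite (diff_affine x).2. Qed.

Lemma nabla_affine2 v w vs : nabla r [:: v, w & vs] = fun=> 0.
Proof.
elim: vs v w => [|u vs IH] v w; apply/funext => x.
  have -> : nabla r [:: v; w] x = 'd (nabla r [:: w]) x v by [].
  by rewrite nabla_affine1 diff_cst.
have -> : nabla r [:: v, w, u & vs] x = 'd (nabla r [:: w, u & vs]) x v by [].
by rewrite IH diff_cst.
Qed.

Lemma nabla_affine_cst x y vs : (0 < size vs)%N -> nabla r vs x = nabla r vs y.
Proof.
by case: vs => [//|u [|w vs]] _; rewrite (nabla_affine1, nabla_affine2).
Qed.

Lemma continuously_differentiable_cst k (a : W) :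
  continuously_differentiable k (fun _ : V => a).
Proof.
elim: k a => [|k IH] a /=; first exact: cst_continuous.
split=> [x|v]; first exact: differentiable_cst.
rewrite (_ : (fun x => _) = fun=> 0); first exact: IH.
by apply/funext => x; rewrite diff_cst.
Qed.

Lemma continuously_differentiable_affine k : continuously_differentiable k r.
Proof.
case: k => [|k] /=.
  by move=> x; apply: differentiable_continuous; exact: (diff_affine x).1.
split=> [x|v]; first exact: (diff_affine x).1.
rewrite (_ : (fun x => _) = fun=> L v); first exact: continuously_differentiable_cst.
by apply/funext => x; rewrite (diff_affine x).2.
Qed.

Lemma taylor_affine j x s : (0 < j)%N -> taylor r j x s = r (x + s).
Proof.
case: j => // j _; rewrite /taylor big_ord_recl big_ord_recl big1 => [|i _].
  by rewrite addr0 fact0 !invr1 !scale1r /= (diff_affine x).2 /r linearD addrA.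
rewrite (_ : nseq _ s = [:: s, s & nseq i s]) //.
by rewrite nabla_affine2 scaler0.
Qed.

(** The derivative tensors of positive order are constant, so any Lipschitz
constant does. *)
Lemma lipschitz_derivatives_affine (nW : W -> R) p (F : set V) :
  nW 0 = 0 -> lipschitz_derivatives nW p F r.
Proof.
move=> nW0; split; first exact: continuously_differentiable_affine.
exists setT; split => //; first exact: openT.
move=> [//|j] _; exists 1 => // x y _ _; apply: ge_ereal_sup => _ [v _ <-].
rewrite lee_fin mul1r (_ : nabla r v x - nabla r v y = 0); last first.
  by rewrite (nabla_affine_cst x y) ?size_tuple // subrr.
by rewrite nW0 sqrtr_ge0.
Qed.

End Affine.

Lemma taylor_taylor_affine (R : realType) (n : nat) (W : normedModType R)
    (b : W) (L : {linear 'rV[R]_n -> W}) j k x s d :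
  continuous L -> (0 < j)%N -> (0 < k)%N ->
  taylor (taylor (fun x => b + L x) j x) k s d = b + L (x + s + d).
Proof.
move=> L_cont j0 k0.
have -> : taylor (fun x => b + L x) j x = fun s => (b + L x) + L s.
  by apply/funext => u; rewrite taylor_affine // linearD addrA.
by rewrite taylor_affine // -addrA -linearD addrA.
Qed.

(** * The Euclidean norm and its powers in dimension one *)

Section Line.
Context {R : realType}.

Lemma inf_min (A : set R) a : A a -> lbound A a -> inf A = a.
Proof.
move=> Aa lba; apply/eqP; rewrite eq_le; apply/andP; split.
  by apply: ge_inf => //; exists a.
by apply: lb_le_inf => //; exists a.
Qed.

Lemma enorm1 (x : 'rV[R]_1) : enorm x = `|x 0 0|.
Proof. by rewrite /enorm big_ord1 sqrtr_sqr. Qed.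

(** Away from the origin the norm is, up to sign, the coordinate; hence the chain
rule through the coordinate function. *)
Lemma diff_enorm_pow k (s d : 'rV[R]_1) : 0 < s 0 0 ->
  'd ((fun t => enorm t ^+ k.+1) : 'rV[R]_1 -> R^o) s d
  = k.+1%:R * s 0 0 ^+ k * d 0 0.
Proof.
move=> s0.
pose g : R -> R := fun u => `|u| ^+ k.+1.
pose pr : 'rV[R]_1 -> R := fun t => t 0 0.
have -> : (fun t => enorm t ^+ k.+1) = g \o pr.
  by apply/funext => t /=; rewrite enorm1.
have dg : is_derive (pr s) (1:R) g (k.+1%:R * s 0 0 ^+ k).
  apply: (@near_eq_is_derive _ _ _ (fun u : R => u ^+ k.+1)).
    near=> u; rewrite /g gtr0_norm //; near: u.
    exact: lt_nbhsr.
  apply: DeriveDef; first exact: exprn_derivable.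
  by rewrite exp_derive -[LHS]/(_ * _ * 1) mulr1.
have dpr : differentiable pr s by exact: differentiable_coord.
have dg' : differentiable g (pr s) by apply/derivable1_diffP.
rewrite diff_comp //= diff1E //= derive1E.
rewrite (@derive_val _ _ _ _ _ _ _ dg).
have pr_lin : linear pr by move=> a u v; rewrite /pr !mxE.
pose prL : {linear 'rV[R]_1 -> R} :=
  HB.pack pr (GRing.isLinear.Build _ _ _ _ pr pr_lin).
have -> : 'd pr s = prL :> (_ -> _).
  by rewrite -(@diff_lin _ _ _ prL s) //; exact: coord_continuous.
by rewrite [LHS]mulrC.
Unshelve. all: by end_near.
Qed.

End Line.

(** * Scaled distance to the right end of a segment *)

Section Instance.
Context {R : realType} (a B : R).
Hypothesis a_gt0 : 0 < a.
Local Notation V := 'rV[R]_1.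

Definition dist_problem : problem R 1 1 :=
  Problem [set x | 0 <= x 0 0 <= B] (fun=> 0)
    (fun x => const_mx (a * B) + (- a) *: x) (fun y => `|y 0 0|).
Local Notation P := dist_problem.

Lemma obj_f_affine : obj_f P = fun x => 0 + (\0 : {linear V -> R^o}) x.
Proof. by apply/funext => x; rewrite addr0. Qed.

Lemma obj_c_affine :
  obj_c P = fun x => const_mx (a * B) + ( *:%R (- a) : {linear V -> V}) x.
Proof. by []. Qed.

Lemma obj_w_dist x : feasible P x -> obj_w P x = a * (B - x 0 0).
Proof.
case/andP => _ xB; rewrite /obj_w /= !mxE add0r mulNr -mulrBr.
by rewrite ger0_norm // mulr_ge0 ?subr_ge0 // ltW.
Qed.

Lemma taylor_w_dist j x s : (0 < j)%N -> feasible P (x + s) ->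
  taylor_w P j x s = a * (B - (x 0 0 + s 0 0)).
Proof.
move=> j0 Fs; transitivity (obj_w P (x + s)); last by rewrite obj_w_dist // mxE.
rewrite /taylor_w /obj_w obj_f_affine obj_c_affine !taylor_affine //.
- exact: scaler_continuous.
- exact: cst_continuous.
Qed.

Lemma model_taylor_dist p sigma x s d : (0 < p)%N -> feasible P (x + s + d) ->
  model_taylor P p sigma x 1 s d
  = a * (B - (x 0 0 + s 0 0 + d 0 0))
    + sigma / (p.+1)`!%:R * (enorm s ^+ p.+1
      + 'd ((fun t => enorm t ^+ p.+1) : V -> R^o) s d).
Proof.
move=> p0 Fsd; rewrite /model_taylor obj_f_affine obj_c_affine.
rewrite !taylor_taylor_affine //.
- have := obj_w_dist _ Fsd; rewrite /obj_w obj_f_affine obj_c_affine => ->.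
  rewrite !mxE; congr (_ + _ * _).
  by rewrite /taylor big_ord_recl big_ord1 /= fact0 invr1 !scale1r.
- exact: scaler_continuous.
- exact: cst_continuous.
Qed.

(** The points [y + d] feasible within radius [delta] form a segment, and an
affine function on a segment is minimal at the end selected by its slope. *)
Lemma has_min_affine (u b delta : R) (y : V) : 0 < delta -> feasible P y ->
  has_min [set u + b * d 0 0
          | d in [set d : V | feasible P (y + d) /\ enorm d <= delta]].
Proof.
move=> delta0 /andP[y0 yB].
set lo := Num.max (- y 0 0) (- delta); set hi := Num.min (B - y 0 0) delta.
have inP (d : V) :
    (feasible P (y + d) /\ enorm d <= delta) <-> (lo <= d 0 0 <= hi).
  rewrite enorm1 ler_norml /= !mxE ge_max le_min.
  split=> [[/andP[H1 H2] /andP[H3 H4]]|/andP[/andP[H1 H2] /andP[H3 H4]]].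
    by apply/andP; split; apply/andP; split => //; lra.
  by split; apply/andP; split => //; lra.
have lohi : lo <= hi.
  by rewrite ge_max !le_min; apply/andP; split; apply/andP; split; lra.
have [b0|/ltW b0] := leP 0 b.
- exists (u + b * lo).
    by exists (const_mx lo); [apply/inP; rewrite mxE lexx|rewrite mxE].
  by move=> _ [d /inP /andP[dlo _] <-]; rewrite lerD2l ler_wpM2l.
- exists (u + b * hi).
    by exists (const_mx hi); [apply/inP; rewrite mxE lohi lexx|rewrite mxE].
  by move=> _ [d /inP /andP[_ dhi] <-]; rewrite lerD2l ler_wnM2l.
Qed.

(** Every one of the sets of values is the image of a segment under an affine
map. For the regularization term this uses only that the differential is linear
(it is a linear map by construction, even where the function is not
differentiable). *)
Lemma minima_attained_dist p : (0 < p)%N -> minima_attained P p 1.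
Proof.
move=> p0; split=> [j delta x|sigma j delta x s _]; case: j => [//|[_|//]] delta0.
- move=> Fx; have := has_min_affine (a * (B - x 0 0)) (- a) _ _ delta0 Fx.
  congr has_min; apply: eq_imagel => d [Fd _].
  by rewrite taylor_w_dist //; ring.
- move=> Fx Fs; set K := sigma / (p.+1)`!%:R.
  set D := 'd ((fun t => enorm t ^+ p.+1) : V -> R^o) s.
  have := has_min_affine (a * (B - (x 0 0 + s 0 0)) + K * enorm s ^+ p.+1)
    (- a + K * D 1) _ _ delta0 Fs.
  congr has_min; apply: eq_imagel => d [Fd _].
  have Dd : D d = d 0 0 * D 1.
    transitivity (D (d 0 0 *: 1)); last by rewrite linearZ.
    congr (D _).
    by apply/matrixP => i k; rewrite !mxE !ord1 mulr1.
  by rewrite model_taylor_dist // -/K Dd; ring.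
Qed.

Lemma AS3_dist : AS3 P.
Proof.
split => [|x y|] /=; last by rewrite mxE normr0.
- by exists 1 => // x y; rewrite mul1r enorm1 !mxE; exact: ler_dist_dist.
- by rewrite mxE; exact: ler_normD.
Qed.

Lemma AS4_dist : AS4 P.
Proof.
exists 0 => x Fx; rewrite obj_w_dist // mulr_ge0 ?subr_ge0 //; first exact: ltW.
by case/andP: Fx.
Qed.

Lemma convex_obj_h : convex_function setT (obj_h P).
Proof.
move=> t x y _ _ /=.
rewrite convRE !mxE (le_trans (ler_normD _ _)) // !normrM.
by rewrite (@ger0_norm _ t%:num) // (@ger0_norm _ (1 - t%:num)) ?subr_ge0.
Qed.

(** Moving to the right is what decreases the objective, and the move is limited
either by the radius 1 or by the end of the segment. *)
Lemma phi_w_dist (x : V) :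
  feasible P x -> phi_w P 1 1 x = a * Num.min 1 (B - x 0 0).
Proof.
move=> Fx; have /andP[x0 xB] := Fx; set r := Num.min 1 _.
have r_ge0 : 0 <= r by rewrite le_min ler01 subr_ge0.
have r_le : r <= 1 /\ r <= B - x 0 0 by rewrite !ge_min !lexx orbT.
have Fr : feasible P (x + const_mx r) by apply/andP; rewrite !mxE; split; lra.
rewrite /phi_w obj_w_dist // (@inf_min _ _ (a * (B - (x 0 0 + r)))); first ring.
- exists (const_mx r); last by rewrite taylor_w_dist // mxE.
  by split=> //; rewrite enorm1 mxE ger0_norm //; lra.
- move=> _ [d [Fd dle] <-]; rewrite taylor_w_dist // ler_pM2l // lerD2l lerN2.
  rewrite lerD2l le_min; move: dle; rewrite enorm1 ler_norml => /andP[_ ->] /=.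
  by case/andP: Fd => _; rewrite mxE; lra.
Qed.

(** The regularization weight [sigma] is tuned so that the step [t] is the exact
minimizer of the model: there the slopes of the objective and of the
regularization term cancel. *)
Section ExactStep.
Variables (p : nat) (sigma t : R).
Hypotheses (p_gt0 : (0 < p)%N) (t_gt0 : 0 < t).
Hypothesis stationary : sigma * t ^+ p = a * p`!%:R.

Lemma regularization_slope : sigma / (p.+1)`!%:R * (p.+1%:R * t ^+ p) = a.
Proof.
have p1 : p.+1%:R != 0 :> R by rewrite pnatr_eq0.
have pf : p`!%:R != 0 :> R by rewrite pnatr_eq0 -lt0n fact_gt0.
apply: (mulIf pf); rewrite -stationary factS natrM.
move: p.+1%:R p`!%:R p1 pf => n m n_neq0 m_neq0.
by field; rewrite n_neq0 m_neq0.
Qed.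

Lemma model_exact_step (x : V) : feasible P (x + const_mx t) ->
  model P p sigma x (const_mx t)
  = a * (B - (x 0 0 + t)) + sigma / (p.+1)`!%:R * t ^+ p.+1.
Proof.
by move=> Fs; rewrite /model taylor_w_dist // enorm1 !mxE gtr0_norm.
Qed.

(** The decrease of the objective is [a * t] while the regularization term costs
only [a * t / (p + 1)]. *)
Lemma model_decrease (x : V) : feasible P x -> feasible P (x + const_mx t) ->
  model P p sigma x (const_mx t) <= model P p sigma x 0.
Proof.
move=> Fx Fs; rewrite model_exact_step // /model taylor_w_dist ?addr0 //.
rewrite enorm1 !mxE normr0 expr0n mulr0 !addr0.
set K := sigma / _; have slope : K * (p.+1%:R * t ^+ p) = a.
  exact: regularization_slope.
have K_ge0 : 0 <= K * t ^+ p.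
  rewrite -(@pmulr_lge0 _ p.+1%:R) ?ltr0n // -mulrA [_ * p.+1%:R]mulrC slope.
  exact: ltW.
have le_a : K * t ^+ p <= a.
  by rewrite -slope mulrCA ler_peMl // ler1n.
have : K * t ^+ p * t <= a * t by rewrite ler_pM2r.
by rewrite exprSr mulrA; lra.
Qed.

(** At the stationary step the first-order expansion of the model is constant, so
that every feasible point is a minimizer. *)
Lemma phi_model_exact_step delta (x : V) : 0 < delta ->
  feasible P (x + const_mx t) -> phi_model P p sigma x 1 delta (const_mx t) = 0.
Proof.
move=> delta0 Fs; rewrite /phi_model model_exact_step //.
set v := _ + _ * _.
have flat d : feasible P (x + const_mx t + d) ->
    model_taylor P p sigma x 1 (const_mx t) d = v.
  move=> Fd; rewrite model_taylor_dist // diff_enorm_pow ?mxE //.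
  rewrite enorm1 mxE gtr0_norm // [_ / _ * (_ + _)]mulrDr.
  by rewrite [_ / _ * (_ * d 0 0)]mulrA regularization_slope /v; ring.
rewrite (@inf_min _ _ v) ?subrr //.
- exists 0; last by rewrite flat // addr0.
  by split; [rewrite addr0|rewrite enorm1 mxE normr0 ltW].
- by move=> _ [d [Fd _] <-]; rewrite flat.
Qed.

End ExactStep.

End Instance.

(** * The run of the algorithm *)

Section Run.
Context {R : realType} (p N : nat) (eps t : R).
Hypotheses (p_gt0 : (0 < p)%N) (eps_bounds : 0 < eps < 1).
Hypotheses (t_gt0 : 0 < t) (t_root : t ^+ p = eps).

Let eps_gt0 : 0 < eps. Proof. by case/andP: eps_bounds. Qed.
Let slope_gt0 : 0 < 2 * eps. Proof. by rewrite mulr_gt0. Qed.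

(** The excess 1/2 over the [N] steps makes [N] the first index at which the
remaining distance [r] satisfies [2 * eps * min 1 r <= eps]. *)
Definition run_problem : problem R 1 1 :=
  dist_problem (2 * eps) (N%:R * t + 2^-1).
Local Notation P := run_problem.

Definition run_parameters : parameters R 1 1 :=
  AlgParams 0 (2 * p`!%:R) (const_mx eps) (const_mx 1) 2^-1 (2 * p`!%:R)
    2^-1 2^-1 2^-1 2 3.
Local Notation par := run_parameters.

Definition run_iterates : iterates R 1 1 :=
  Iterates (fun k => const_mx (k%:R * t)) (fun=> const_mx t)
    (fun=> const_mx 1) (fun=> const_mx 1) (fun=> 2 * p`!%:R).
Local Notation it := run_iterates.

Lemma feasible_run k : (k <= N)%N -> feasible P (const_mx (k%:R * t)).
Proof.
move=> kN; rewrite /= mxE mulr_ge0 ?ler0n 1?ltW //=.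
have : k%:R * t <= N%:R * t by rewrite ler_pM2r // ler_nat.
by lra.
Qed.

Lemma run_step k :
  const_mx (k%:R * t) + const_mx t = const_mx (k.+1%:R * t) :> 'rV[R]_1.
Proof. by apply/matrixP => i j; rewrite !mxE -natr1 mulrDl mul1r. Qed.

Lemma feasible_run_step k :
  (k < N)%N -> feasible P (const_mx (k%:R * t) + const_mx t).
Proof. by move=> kN; rewrite run_step; exact: feasible_run. Qed.

Lemma run_stationary : 2 * p`!%:R * t ^+ p = 2 * eps * p`!%:R.
Proof. by rewrite t_root; ring. Qed.

Lemma rho_run k : (k < N)%N -> rho P p it k = 1.
Proof.
move=> kN; have Fk := feasible_run _ (ltnW kN).
have Fs := feasible_run_step _ kN.
rewrite /rho /= taylor_w_dist // !obj_w_dist // !mxE -mulrBr.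
rewrite divff // mulf_neq0 ?gt_eqF //.
by rewrite (_ : _ - _ = t) //; ring.
Qed.

Lemma successful_run k : (k < N)%N -> successful P p par it k.
Proof. by move=> kN; rewrite /successful rho_run //=; lra. Qed.

Lemma enters_step1_run k : (k <= N)%N -> enters_step1 P p par it k.
Proof. by case: k => [//|k] kN; exact: successful_run. Qed.

Lemma phi_w_run k : (k < N)%N -> eps < phi_w P 1 1 (it_x it k).
Proof.
move=> kN; rewrite phi_w_dist //; last exact: (feasible_run _ (ltnW kN)).
rewrite mulrAC -[ltLHS]mul1r ltr_pM2r // -ltr_pdivrMl // mulr1 lt_min mxE.
have : k%:R * t < N%:R * t by rewrite ltr_pM2r // ltr_nat.
by move=> ?; apply/andP; split; lra.
Qed.

Lemma phi_w_last : phi_w P 1 1 (it_x it N) <= eps.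
Proof.
rewrite phi_w_dist //; last exact: feasible_run.
rewrite mulrAC -[leRHS]mul1r ler_pM2r // -ler_pdivlMl // mulr1 ge_min mxE.
by apply/orP; right; lra.
Qed.

Lemma step1_stop_run k :
  step1_stop P par (it_x it k) (it_delta it k) = (phi_w P 1 1 (it_x it k) <= eps).
Proof.
rewrite /step1_stop /=; apply/forallP/idP => [/(_ 0)|le_eps i].
  by rewrite !mxE expr1 divr1 mulr1.
by rewrite ord1 !mxE expr1 divr1 mulr1.
Qed.

Lemma not_stops_run k : (k < N)%N -> ~~ stops_at_step1 P p par it k.
Proof.
move=> kN; rewrite /stops_at_step1 step1_stop_run negb_and -ltNge.
by rewrite phi_w_run ?orbT.
Qed.

Lemma step2_pair_run k : (k < N)%N ->
  step2_pair P p par (it_x it k) (it_sigma it k) (it_s it k) (it_delta_s it k).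
Proof.
move=> kN; have Fs := feasible_run_step _ kN.
have Fk := feasible_run _ (ltnW kN).
split => //.
- apply/eqP => /matrixP/(_ 0 0); rewrite !mxE => /eqP.
  by rewrite gt_eqF.
- by move=> i; rewrite mxE ltr01 lexx.
- by apply: model_decrease => //; exact: run_stationary.
- move=> i; rewrite ord1 /= !mxE phi_model_exact_step //.
    by rewrite expr1n !mulr1 divr1 mulr_ge0 // ltW.
  exact: run_stationary.
Qed.

Let sigma_gt0 : 0 < 2 * p`!%:R :> R.
Proof. by rewrite mulr_gt0 // ltr0n fact_gt0. Qed.

Lemma complete_iteration_run k : (k < N)%N -> complete_iteration P p par it k.
Proof.
move=> kN; split.
- exact: not_stops_run.
- exact: step2_pair_run.
- by rewrite successful_run //= run_step.
- by case: ifP.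
- by split; rewrite rho_run //= ?ge_max ?lexx => rho1; move: sigma_gt0; lra.
Qed.

Lemma valid_run_parameters : valid_parameters P p par.
Proof.
split; [by rewrite p_gt0|split; split => /=].
- rewrite mxE lexx /=; have : 0 <= N%:R * t by rewrite mulr_ge0 ?ler0n ?ltW.
  by lra.
- by rewrite sigma_gt0 lexx.
- by move=> i; rewrite mxE.
- by move=> i; rewrite mxE ltr01 lexx.
all: by lra.
Qed.

Lemma execution_run : execution P p par it N.
Proof.
split => //=.
- by apply/matrixP => i j; rewrite !mxE mul0r.
- exact: complete_iteration_run.
- by left; rewrite /stops_at_step1 enters_step1_run // step1_stop_run phi_w_last.
Qed.

(** Every iteration enters Step 1 and none of the first [N] stops there, so each
of them evaluates the derivatives of all orders. *)
Lemma derivative_evaluations_run j :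
  (N <= derivative_evaluations P p par it N j)%N.
Proof.
rewrite /derivative_evaluations big_mkcond big_ord_recr /=.
apply: leq_trans (leq_addr _ _).
rewrite (eq_bigr (fun=> 1%N)) ?sum1_card ?card_ord // => k _.
have kN : (k < N)%N by [].
by rewrite enters_step1_run ?not_stops_run ?orbT //= ltnW.
Qed.

End Run.

(** * The lower bound *)

Theorem corollary6p3 (R : realType) (p : nat) (hp : (1 <= p)%N)
    (eps : R) (heps : 0 < eps < 1) :
  exists (n m : nat) (P : problem R n m) (par : parameters R n 1%N)
         (it : iterates R n 1%N) (N : nat),
    [/\ (1 <= n)%N, (1 <= m)%N & feasible P !=set0] /\
    [/\ AS1 P p, AS2 P p, AS3 P & AS4 P] /\
    minima_attained P p 1%N /\
    (convex_function setT (obj_h P) /\ exists y, obj_h P y != 0) /\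
    [/\ valid_parameters P p par, par_eps par = const_mx eps
      & execution P p par it N] /\
    (phi_w P 1%N 1 (it_x it N) <= eps /\
     forall k, (k < N)%N -> eps < phi_w P 1%N 1 (it_x it k)) /\
    [/\ eps `^ (- (p.+1%:R / p%:R)) <= N%:R,
        eps `^ (- (p.+1%:R / p%:R)) <= (function_evaluations N)%:R
      & forall j, (1 <= j <= p)%N ->
          eps `^ (- (p.+1%:R / p%:R))
            <= (derivative_evaluations P p par it N j)%:R].
Proof.
have [eps0 _] := andP heps.
set lower := eps `^ (- _); pose N := (Num.truncn lower).+1.
have lowerN : lower <= N%:R by apply: ltW; exact: truncnS_gt.
pose t := eps `^ p%:R^-1.
have t0 : 0 < t by exact: powR_gt0.
have tp : t ^+ p = eps.
  rewrite -powR_mulrn ?powR_ge0 // -powRrM mulVf ?powRr1 1?ltW //.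
  by rewrite pnatr_eq0 -lt0n.
have slope0 : 0 < 2 * eps by rewrite mulr_gt0.
exists 1%N, 1%N, (run_problem N eps t), (run_parameters p eps), (run_iterates p t).
exists N; split.
  by split => //; exists (const_mx (0%:R * t)); exact: feasible_run.
split.
  split; [| |exact: AS3_dist|exact: AS4_dist].
  - rewrite /AS1 obj_f_affine; apply: lipschitz_derivatives_affine.
      exact: cst_continuous.
    exact: normr0.
  - rewrite /AS2 obj_c_affine; apply: lipschitz_derivatives_affine.
      exact: scaler_continuous.
    by rewrite enorm1 mxE normr0.
split; first exact: minima_attained_dist.
split.
  split; first exact: convex_obj_h.
  by exists (const_mx 1); rewrite /= mxE normr1 oner_eq0.
split.
  by split => //; [exact: valid_run_parameters|exact: execution_run].
split.
  by split=> [|k kN]; [exact: phi_w_last|exact: phi_w_run].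
split => //.
- by apply: le_trans lowerN _; rewrite ler_nat.
- move=> j _; apply: le_trans lowerN _.
  by rewrite ler_nat derivative_evaluations_run.
Qed.
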